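(* (Generalized Kallianpur–Striebel formula.) Let $h\in\mathcal A_X(T)$ and let $\varphi=\varphi(t,x;y):[0,T]\times\mathbb R^n\times\mathbb R^{m^Y}\to\mathbb R$ be in $C_b^{1,2}$ (indexed by $y$). Then, for $t\in[0,T]$, $$\mathbf E^h\left[\varphi(t,X_t;Y_t)e^{\theta\int_0^tg(s,X_s,Y_s,h_s;\theta)ds}\,\Big|\,\mathcal F^Y_t\right]=\frac{\bar{\mathbf E}\left[\varphi(t,X_t;Y_t)e^{\theta\int_0^tg(s,X_s,Y_s,h_s;\theta)ds}\,\Psi^X_t\,\Big|\,\mathcal F^Y_t\right]}{\bar{\mathbf E}\left[\Psi^X_t\,\Big|\,\mathcal F^Y_t\right]}=\frac{q^h_X(t)(\varphi_t)}{\bar{\mathbf E}\left[\Psi^X_t\,\Big|\,\mathcal F^Y_t\right]},$$ where $\mathbf E^h$ and $\bar{\mathbf E}$ are the expectations with respect to $\mathbb P^h$ and $\bar{\mathbb P}$ respectively.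
   Context: A prime denotes transposition. Fix $T<\infty$, integers $\ell,k\ge0$, $n,m\ge1$, $m=m_1+m_2$ with $m_1\ge1$, $m_2\ge0$; put $m^Y=\ell+m+k+1$ and $d=\ell+n+m+k+1$. On a filtered complete probability space $(\Omega,\mathcal F,(\mathcal F_t)_{0\le t\le T},\mathbb P)$ let $W_t$ be an $\mathbb R^d$-valued $\mathcal F_t$-Wiener process; $\mathbf E$ is expectation under $\mathbb P$. Model. The unobservable factor $X_t\in\mathbb R^n$ and the observation $Y_t\in\mathbb R^{m^Y}$ satisfy $$dX_t=b(t,X_t,Y_t)dt+\Lambda(t,X_t,Y_t)dW_t,\qquad dY_t=a^Y(t,X_t,Y_t)dt+\Sigma^Y(t,Y_t)dW_t,\quad Y_0=y_0,$$ where $X_0$ has a known distribution and is independent of $W$. The coefficients are $C_b^{1,1,1}$ functions (of time, $x$, $y$), respectively $C_b^{1,1}$ functions (of time, $y$), such that strong solutions exist. The process $Y_t=(F_t',(\ln S_t)',\ln L_t,E_t')'$ stacks $\ell$ observable factors, $m$ log asset prices, a log benchmark and $k$ expert forecasts, with corresponding blocks $$a^Y=\left((b^f)',(a-\tfrac12 d_\Sigma)',c-\tfrac12\Xi\Xi',(a^E)'\right)',\qquad \Sigma^Y=\left((\Lambda^f)',\Sigma',\Xi',(\Sigma^E)'\right)',$$ where $b^f(t,x,y)\in\mathbb R^\ell$, $a(t,x,y)\in\mathbb R^m$, $c(t,x,y)\in\mathbb R$, $a^E(t,x,y)\in\mathbb R^k$, $\Lambda^f(t,y)\in\mathbb R^{\ell\times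 d}$, $\Sigma(t,y)\in\mathbb R^{m\times d}$, $\Xi(t,y)\in\mathbb R^{1\times d}$, $\Sigma^E(t,y)\in\mathbb R^{k\times d}$, and $d_\Sigma$ is the vector of diagonal entries of $\Sigma\Sigma'$. $\Sigma\Sigma'$ is positive definite, and $\Sigma^Y\Sigma^{Y'}$ is invertible. $a^{(1)}$ and $\Sigma^{(1)}$ denote the first $m_1$ entries of $a$ and the first $m_1$ rows of $\Sigma$. $\mathcal F^Y_t=\sigma\{Y_u:0\le u\le t\}$. Notation such as $\Sigma\Sigma'(t,y)$ means $\Sigma(t,y)\Sigma'(t,y)$. Control measure. $\theta\in(-1,0)\cup(0,\infty)$. With $\gamma_s:=h_s'\Sigma^{(1)}(s,Y_s)-\Xi(s,Y_s)$, $\mathbb P^h$ is defined by $$\frac{d\mathbb P^h}{d\mathbb P}\Big|_{\mathcal F_t}=\chi^h_t=\exp\left\{-\theta\int_0^t\gamma_s\,dW_s-\tfrac{\theta^2}{2}\int_0^t\gamma_s\gamma_s'ds\right\},$$ with $(\mathbb P^h,\mathcal F_t)$-Wiener process $W^h_t=W_t+\theta\int_0^t\gamma_s'ds$. Put $$a^\dagger(t,x,y;h)=a^Y(t,x,y)-\theta\Sigma^Y(t,y)\left(\Sigma^{(1)'}(t,y)h-\Xi'(t,y)\right),$$ $$g(t,x,y,h;\theta)=\tfrac{\theta+1}{2}h'\Sigma^{(1)}\Sigma^{(1)'}(t,y)h-h'a^{(1)}(t,x,y)-\theta h'\Sigma^{(1)}\Xi'(t,y)+c(t,x,y)+\tfrac{\theta-1}{2}\Xi\Xi'(t,y).$$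 Class $\mathcal A_X(T)$: $\mathbb R^{m_1}$-valued processes $h_t$ such that (i) $h_t$ is progressively measurable with respect to $\{\mathcal B([0,t])\otimes\mathcal F^Y_t\}_{t\ge0}$ and càdlàg; (ii) $\mathbb P(\int_0^T|h_s|^2ds<\infty)=1$; (iii) for $t\in[0,T]$, $\mathbf E[\exp\{-\frac\theta2\int_0^t\gamma_s\,dW_s\}]<\infty$ and $\mathbf E^h[\exp\{-\frac12\int_0^ta^\dagger(s,X_s,Y_s;h_s)'(\Sigma^Y\Sigma^{Y'}(s,Y_s))^{-1}\Sigma^Y(s,Y_s)dW^h_s\}]<\infty$. (These conditions are imposed in order that $\chi^h$ and $\bar\chi^X$ below be martingales.) Filtering measure. $\bar{\mathbb P}$ is defined by $\frac{d\bar{\mathbb P}}{d\mathbb P^h}\big|_{\mathcal F_t}=\bar\chi^X_t$ with $$\bar\chi^X_t=\exp\left\{-\int_0^ta^\dagger(s,X_s,Y_s;h_s)'(\Sigma^Y\Sigma^{Y'}(s,Y_s))^{-1}\Sigma^Y(s,Y_s)dW^h_s-\tfrac12\int_0^ta^\dagger(s,X_s,Y_s;h_s)'(\Sigma^Y\Sigma^{Y'}(s,Y_s))^{-1}a^\dagger(s,X_s,Y_s;h_s)ds\right\},$$ $\Psi^X_t:=(\bar\chi^X_t)^{-1}=\frac{d\mathbb P^h}{d\bar{\mathbb P}}\big|_{\mathcal F_t}$, and $$q^h_X(t)(\varphi_t):=\bar{\mathbf E}\left[e^{\theta\int_0^tg(s,X_s,Y_s,h_s;\theta)ds}\,\Psi^X_t\,\varphi(t,X_t;Y_t)\,\Big|\,\mathcal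 F^Y_t\right].$$ *)

(* Defs.v *)
From HB Require Import structures.
From mathcomp Require Export all_boot all_order all_algebra.
From mathcomp Require Export all_classical all_reals all_analysis.
From mathcomp Require Export measurable_realfun.
Export Order.TTheory GRing.Theory Num.Theory.
Export numFieldNormedType.Exports.

Set Implicit Arguments.
Unset Strict Implicit.
Unset Printing Implicit Defensive.

Local Open Scope classical_set_scope.
Local Open Scope ring_scope.

Definition dimY (l m1 m2 k : nat) : nat := l + (m1 + m2 + (1 + k)).
Definition dimW (l n m1 m2 k : nat) : nat := l + n + (m1 + m2) + k + 1.

Definition normsq {R : realType} {p : nat} (v : 'rV[R]_p) : R :=
  (v *m v^T) 0 0.

Section smoothness.
Context {R : realType} (T : R).

Definition bounded_continuous (U : topologicalType) (f : R -> U -> R) : Prop :=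
  {within `[0, T] `*` [set: U], continuous (fun z : R * U => f z.1 z.2)} /\
  exists K : R, forall (t : R) u, t \in `[0, T] -> `|f t u| <= K.

(* The time derivative is only required in the open interval; since both f and
   ft are continuous on the closed one, ft is the one-sided derivative at the
   endpoints. *)
Definition time_derivative (U : Type) (f ft : R -> U -> R) : Prop :=
  forall (t : R) u, t \in `]0, T[ -> is_derive t (1 : R) (fun s => f s u) (ft t u).

Definition partial_derivative (p : nat) (i : 'I_p) (f fi : R -> 'cV[R]_p -> R)
    : Prop :=
  forall (t : R) x, t \in `[0, T] ->
    is_derive (0 : R) (1 : R) (fun e => f t (x + e *: delta_mx i 0)) (fi t x).

Definition Cb11 (p : nat) (f : R -> 'cV[R]_p -> R) : Prop :=
  [/\ bounded_continuous f,
      exists2 ft, bounded_continuous ft & time_derivative f ft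
    & forall i, exists2 fi, bounded_continuous fi & partial_derivative i f fi].

Definition Cb111 (n p : nat) (f : R -> 'cV[R]_n -> 'cV[R]_p -> R) : Prop :=
  let uncurried (g : R -> 'cV[R]_n -> 'cV[R]_p -> R) :=
    fun t (z : 'cV[R]_n * 'cV[R]_p) => g t z.1 z.2 in
  [/\ bounded_continuous (uncurried f),
      exists2 ft, bounded_continuous (uncurried ft)
                & time_derivative (uncurried f) (uncurried ft),
      forall i, exists2 fx, bounded_continuous (uncurried fx)
                & forall y, partial_derivative i
                              (fun t x => f t x y) (fun t x => fx t x y)
    & forall i, exists2 fy, bounded_continuous (uncurried fy)
                & forall x, partial_derivative i
                              (fun t y => f t x y) (fun t y => fy t x y)].

Definition Cb12 (n : nat) (f : R -> 'cV[R]_n -> R) : Prop :=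
  [/\ bounded_continuous f,
      exists2 ft, bounded_continuous ft & time_derivative f ft
    & forall i, exists2 fi, bounded_continuous fi /\ partial_derivative i f fi
        & forall j, exists2 fij,
            bounded_continuous fij & partial_derivative j fi fij].

End smoothness.

Section processes.
Context {R : realType} {d : measure_display} {Omega : measurableType d}.
Implicit Types (P Q : probability Omega R) (G : set (set Omega)).
Implicit Types (F : R -> set (set Omega)) (T : R).

Definition measurable_wrt G d' (U : measurableType d') (f : Omega -> U) : Prop :=
  measurable_fun [set: g_sigma_algebraType G]
    (f : g_sigma_algebraType G -> U).

(* The filtration is complete: F 0, hence every F t, contains the null sets. *)
Record complete_filtration P T F : Prop := {
  filtration_complete_space : measure_is_complete P ;
  filtration_sigma : forall t : R, t \in `[0, T] -> sigma_algebra [set: Omega] (F t) ;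
  filtration_sub : forall t : R, t \in `[0, T] -> F t `<=` measurable ;
  filtration_mono : forall s t : R, 0 <= s -> s <= t -> t <= T -> F s `<=` F t ;
  filtration_null : P.-negligible `<=` F 0 }.

Definition adapted T F (p q : nat) (Z : R -> Omega -> 'M[R]_(p, q)) : Prop :=
  forall (t : R) i j, t \in `[0, T] -> measurable_wrt (F t) (fun w => Z t w i j).

Definition continuous_paths T (p q : nat) (Z : R -> Omega -> 'M[R]_(p, q))
    : Prop :=
  forall w i j, {within `[0, T], continuous (fun t => Z t w i j)}.

Definition cadlag T (p q : nat) (Z : R -> Omega -> 'M[R]_(p, q)) : Prop :=
  forall w i j,
    (forall t : R, t \in `[0, T[ -> (fun s => Z s w i j) @ t^'+ --> Z t w i j) /\
    (forall t : R, t \in `]0, T] -> cvg ((fun s => Z s w i j) @ t^'-)).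

Definition progressive T F (p q : nat) (Z : R -> Omega -> 'M[R]_(p, q)) : Prop :=
  forall (t : R) i j, t \in `[0, T] ->
    measurable_fun (`[0, t] `*` [set: g_sigma_algebraType (F t)])
      (fun z : R * g_sigma_algebraType (F t) => Z z.1 z.2 i j).

(* sigma {Z u, 0 <= u <= t} *)
Definition natural_filtration (p : nat) (Z : R -> Omega -> 'cV[R]_p) (t : R)
    : set (set Omega) :=
  <<s [set A | exists u i (B : set R),
         [/\ u \in `[0, t], measurable B & A = (fun w => Z u w i 0) @^-1` B]] >>.

Definition independent_sigma P (G1 G2 : set (set Omega)) : Prop :=
  forall A B, G1 A -> G2 B -> P (A `&` B) = (P A * P B)%E.

Record wiener P T F (p : nat) (W : R -> Omega -> 'cV[R]_p) : Prop := {
  wiener_adapted : adapted T F W ;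
  wiener_continuous : continuous_paths T W ;
  wiener_start : {ae P, forall w, W 0 w = 0} ;
  (* W t - W s is independent of F s with law N(0, (t - s) I_p) *)
  wiener_increments : forall (s t : R) (A : set Omega) (B : 'I_p -> set R),
    0 <= s -> s < t -> t <= T -> F s A -> (forall i, measurable (B i)) ->
    P (A `&` [set w | forall i, B i (W t w i 0 - W s w i 0)]) =
    (P A * \prod_(i < p) normal_prob (0 : R) (Num.sqrt (t - s)) (B i))%E }.

Definition cvg_in_probability0 Q (Z : nat -> Omega -> \bar R) : Prop :=
  forall e : R, 0 < e -> Q [set w | (e%:E <= Z N w)%E] @[N --> \oo] --> 0%E.

(* The process sum_(i < sp_size) sp_coef i * 1_(]sp_time i, sp_time (i + 1)]) *)
Record simple_process (p : nat) := {
  sp_size : nat ;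
  sp_time : nat -> R ;
  sp_coef : nat -> Omega -> 'rV[R]_p }.

Definition simple_predictable T F (p : nat) (S : simple_process p) : Prop :=
  [/\ 0 <= sp_time S 0,
      sp_time S (sp_size S) <= T,
      forall i, (i < sp_size S)%N -> sp_time S i <= sp_time S i.+1
    & forall i, (i < sp_size S)%N ->
        (forall j, measurable_wrt (F (sp_time S i)) (fun w => sp_coef S i w 0 j))
        /\ exists K : R, forall w j, `|sp_coef S i w 0 j| <= K].

Definition simple_value (p : nat) (S : simple_process p) (s : R) (w : Omega)
    : 'rV[R]_p :=
  \sum_(i < sp_size S)
    (\1_(`]sp_time S i, sp_time S i.+1]) s : R) *: sp_coef S i w.

Definition simple_integral (p : nat) (W : R -> Omega -> 'cV[R]_p)
    (S : simple_process p) (t : R) (w : Omega) : R :=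
  \sum_(i < sp_size S)
    (sp_coef S i w *m (W (Num.min (sp_time S i.+1) t) w
                       - W (Num.min (sp_time S i) t) w)) 0 0.

(* I is a continuous adapted version of (int_0^t H dW)_(0 <= t <= T): it is the
   limit in Q-probability of the integrals of simple processes S N with
   int_0^T |S N - H|^2 ds --> 0 in Q-probability. *)
Definition is_ito_integral Q T F (p : nat) (W : R -> Omega -> 'cV[R]_p)
    (H : R -> Omega -> 'rV[R]_p) (I : R -> Omega -> R) : Prop :=
  [/\ progressive T F H,
      (forall t : R, t \in `[0, T] -> measurable_wrt (F t) (I t)),
      (forall w, {within `[0, T], continuous (fun t => I t w)})
    & exists S : nat -> simple_process p,
      [/\ forall N, simple_predictable T F (S N),
          cvg_in_probability0 Q (fun N w =>
            (\int[lebesgue_measure]_(s in `[0%R, T])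
               (normsq (simple_value (S N) s w - H s w))%:E)%E)
        & forall t : R, t \in `[0, T] ->
            cvg_in_probability0 Q (fun N w =>
              (`|simple_integral W (S N) t w - I t w|)%:E)]].

(* Ph has density L t with respect to Q on F t, for every t in [0, T] *)
Definition density_on T F Q Ph (L : R -> Omega -> R) : Prop :=
  forall (t : R) A, t \in `[0, T] -> F t A -> Ph A = (\int[Q]_(w in A) (L t w)%:E)%E.

Definition is_condexp_ge0 Q G (Z V : Omega -> \bar R) : Prop :=
  [/\ measurable_wrt G V, (forall w, 0 <= V w)%E
    & forall A, G A -> (\int[Q]_(w in A) V w = \int[Q]_(w in A) Z w)%E].

(* V is a version of the Q-conditional expectation of Z given G, understood for
   an arbitrary random variable Z as E[Z^+ | G] - E[Z^- | G] in the extended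
   reals (with +oo - +oo = -oo).  For integrable Z this is the usual notion. *)
Definition is_condexp Q G (Z : Omega -> R) (V : Omega -> \bar R) : Prop :=
  exists Vp Vn : Omega -> \bar R,
    [/\ is_condexp_ge0 Q G (fun w => (Num.max (Z w) 0)%:E) Vp,
        is_condexp_ge0 Q G (fun w => (Num.max (- Z w) 0)%:E) Vn
      & forall w, V w = (Vp w - Vn w)%E].

End processes.

(* Coefficients of the factor process and of the blocks of the observation
   (factors, log prices, log benchmark, expert forecasts). *)
Record coefficients (R : realType) (l n m1 m2 k : nat) := {
  cf_b : R -> 'cV[R]_n -> 'cV[R]_(dimY l m1 m2 k) -> 'cV[R]_n ;
  cf_Lambda : R -> 'cV[R]_n -> 'cV[R]_(dimY l m1 m2 k) ->
              'M[R]_(n, dimW l n m1 m2 k) ;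
  cf_bf : R -> 'cV[R]_n -> 'cV[R]_(dimY l m1 m2 k) -> 'cV[R]_l ;
  cf_a : R -> 'cV[R]_n -> 'cV[R]_(dimY l m1 m2 k) -> 'cV[R]_(m1 + m2) ;
  cf_c : R -> 'cV[R]_n -> 'cV[R]_(dimY l m1 m2 k) -> R ;
  cf_aE : R -> 'cV[R]_n -> 'cV[R]_(dimY l m1 m2 k) -> 'cV[R]_k ;
  cf_Lambdaf : R -> 'cV[R]_(dimY l m1 m2 k) -> 'M[R]_(l, dimW l n m1 m2 k) ;
  cf_Sigma : R -> 'cV[R]_(dimY l m1 m2 k) ->
             'M[R]_(m1 + m2, dimW l n m1 m2 k) ;
  cf_Xi : R -> 'cV[R]_(dimY l m1 m2 k) -> 'rV[R]_(dimW l n m1 m2 k) ;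
  cf_SigmaE : R -> 'cV[R]_(dimY l m1 m2 k) -> 'M[R]_(k, dimW l n m1 m2 k) }.

Section model.
Context {R : realType} {l n m1 m2 k : nat}.
Variables (C : coefficients R l n m1 m2 k) (T theta : R).

Local Notation Rn := 'cV[R]_n.
Local Notation RY := 'cV[R]_(dimY l m1 m2 k).
Local Notation RW := 'cV[R]_(dimW l n m1 m2 k).

Definition a1 (t : R) (x : Rn) (y : RY) : 'cV[R]_m1 := usubmx (cf_a C t x y).

Definition Sigma1 (t : R) (y : RY) : 'M[R]_(m1, dimW l n m1 m2 k) :=
  usubmx (cf_Sigma C t y).

Definition SigmaY (t : R) (y : RY) : 'M[R]_(dimY l m1 m2 k, dimW l n m1 m2 k) :=
  col_mx (cf_Lambdaf C t y)
    (col_mx (cf_Sigma C t y) (col_mx (cf_Xi C t y) (cf_SigmaE C t y))).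

Definition SigmaYY (t : R) (y : RY) : 'M[R]_(dimY l m1 m2 k) :=
  SigmaY t y *m (SigmaY t y)^T.

Definition dSigma (t : R) (y : RY) : 'cV[R]_(m1 + m2) :=
  \col_i (cf_Sigma C t y *m (cf_Sigma C t y)^T) i i.

Definition aY (t : R) (x : Rn) (y : RY) : RY :=
  col_mx (cf_bf C t x y)
    (col_mx (cf_a C t x y - 2^-1 *: dSigma t y)
      (col_mx (const_mx (cf_c C t x y - 2^-1 * normsq (cf_Xi C t y)) : 'cV[R]_1)
              (cf_aE C t x y))).

Definition coefficients_regular : Prop :=
  (forall i, Cb111 T (fun t x y => cf_b C t x y i 0)) /\
  (forall i j, Cb111 T (fun t x y => cf_Lambda C t x y i j)) /\
  (forall i, Cb111 T (fun t x y => cf_bf C t x y i 0)) /\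
  (forall i, Cb111 T (fun t x y => cf_a C t x y i 0)) /\
  Cb111 T (cf_c C) /\
  (forall i, Cb111 T (fun t x y => cf_aE C t x y i 0)) /\
  (forall i j, Cb11 T (fun t y => cf_Lambdaf C t y i j)) /\
  (forall i j, Cb11 T (fun t y => cf_Sigma C t y i j)) /\
  (forall i j, Cb11 T (fun t y => cf_Xi C t y i j)) /\
  (forall i j, Cb11 T (fun t y => cf_SigmaE C t y i j)).

Definition coefficients_nondegenerate : Prop :=
  (forall (t : R) y (v : 'cV[R]_(m1 + m2)), t \in `[0, T] -> v != 0 ->
     0 < (v^T *m (cf_Sigma C t y *m (cf_Sigma C t y)^T) *m v) 0 0) /\
  (forall (t : R) y, t \in `[0, T] -> SigmaYY t y \in unitmx).

Definition adagger (t : R) (x : Rn) (y : RY) (h : 'cV[R]_m1) : RY :=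
  aY t x y -
  theta *: (SigmaY t y *m ((Sigma1 t y)^T *m h - (cf_Xi C t y)^T)).

Definition gcost (t : R) (x : Rn) (y : RY) (h : 'cV[R]_m1) : R :=
  (theta + 1) / 2 * (h^T *m (Sigma1 t y *m (Sigma1 t y)^T) *m h) 0 0
  - (h^T *m a1 t x y) 0 0
  - theta * (h^T *m (Sigma1 t y *m (cf_Xi C t y)^T)) 0 0
  + cf_c C t x y
  + (theta - 1) / 2 * normsq (cf_Xi C t y).

Section paths.
Context {d : measure_display} {Omega : measurableType d}.
Variables (P : probability Omega R) (F : R -> set (set Omega)).
Variables (W : R -> Omega -> RW) (X : R -> Omega -> Rn) (Y : R -> Omega -> RY).
Variable h : R -> Omega -> 'cV[R]_m1.

(* An Ito equation Z t = Z 0 + int_0^t drift ds + int_0^t diff dW is expressed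
   by saying that, for each i, Z t i - Z 0 i - int_0^t drift_i ds is a version
   of the Ito integral of the i-th row of diff. *)
Definition ito_equation (p : nat) (Z : R -> Omega -> 'cV[R]_p)
    (drift : R -> Omega -> 'cV[R]_p)
    (diff : R -> Omega -> 'M[R]_(p, dimW l n m1 m2 k)) : Prop :=
  forall i, is_ito_integral P T F W (fun s w => row i (diff s w))
    (fun t w => Z t w i 0 - Z 0 w i 0
                - \int[lebesgue_measure]_(s in `[0, t]) (drift s w i 0)).

Record model_solution (mu0 : set Rn -> \bar R) (y0 : RY) : Prop := {
  solution_X_adapted : adapted T F X ;
  solution_X_continuous : continuous_paths T X ;
  solution_Y_adapted : adapted T F Y ;
  solution_Y_continuous : continuous_paths T Y ;
  solution_X_law : forall B, (@open Rn).-sigma.-measurable B ->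
    P (X 0 @^-1` B) = mu0 B ;
  solution_X_independent :
    independent_sigma P (natural_filtration X 0) (natural_filtration W T) ;
  solution_Y_start : {ae P, forall w, Y 0 w = y0} ;
  solution_X : ito_equation X (fun s w => cf_b C s (X s w) (Y s w))
                              (fun s w => cf_Lambda C s (X s w) (Y s w)) ;
  solution_Y : ito_equation Y (fun s w => aY s (X s w) (Y s w))
                              (fun s w => SigmaY s (Y s w)) }.

Definition gamma (s : R) (w : Omega) : 'rV[R]_(dimW l n m1 m2 k) :=
  (h s w)^T *m Sigma1 s (Y s w) - cf_Xi C s (Y s w).

(* Below, I and J stand for versions of the Ito integrals of gamma with respect
   to W (under P) and of filter_integrand with respect to Wh (under Ph). *)
Definition chi (I : R -> Omega -> R) (t : R) (w : Omega) : R :=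
  expR (- theta * I t w
        - theta ^+ 2 / 2 *
          \int[lebesgue_measure]_(s in `[0, t]) (normsq (gamma s w))).

Definition Wh (t : R) (w : Omega) : RW :=
  W t w + theta *:
    \col_i (\int[lebesgue_measure]_(s in `[0, t]) ((gamma s w)^T i 0)).

Definition filter_integrand (s : R) (w : Omega) : 'rV[R]_(dimW l n m1 m2 k) :=
  (adagger s (X s w) (Y s w) (h s w))^T *m invmx (SigmaYY s (Y s w))
  *m SigmaY s (Y s w).

Definition chibar (J : R -> Omega -> R) (t : R) (w : Omega) : R :=
  expR (- J t w
        - 2^-1 * \int[lebesgue_measure]_(s in `[0, t])
            (((adagger s (X s w) (Y s w) (h s w))^T
              *m invmx (SigmaYY s (Y s w))
              *m adagger s (X s w) (Y s w) (h s w)) 0 0)).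

Definition PsiX (J : R -> Omega -> R) (t : R) (w : Omega) : R :=
  (chibar J t w)^-1.

Definition exp_cost (t : R) (w : Omega) : R :=
  expR (theta * \int[lebesgue_measure]_(s in `[0, t])
                  (gcost s (X s w) (Y s w) (h s w))).

Record classAX (Ph : probability Omega R) (I J : R -> Omega -> R) : Prop := {
  classAX_progressive : progressive T (natural_filtration Y) h ;
  classAX_cadlag : cadlag T h ;
  classAX_square_integrable : {ae P, forall w,
    (\int[lebesgue_measure]_(s in `[0%R, T]) (normsq (h s w)^T)%:E < +oo)%E} ;
  classAX_chi : forall t : R, t \in `[0, T] ->
    (\int[P]_w (expR (- (theta / 2) * I t w))%:E < +oo)%E ;
  classAX_chibar : forall t : R, t \in `[0, T] ->
    (\int[Ph]_w (expR (- 2^-1 * J t w))%:E < +oo)%E }.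

(* q is a version of q^h_X(t)(phi_t) *)
Definition is_qX (Pbar : probability Omega R) (J : R -> Omega -> R)
    (phi : R -> Rn -> RY -> R) (t : R) (q : Omega -> \bar R) : Prop :=
  is_condexp Pbar (natural_filtration Y t)
    (fun w => exp_cost t w * PsiX J t w * phi t (X t w) (Y t w)) q.

End paths.
End model.

(* The test functions are C_b^{1,2} in (t, x) for each y, and Borel in (x, y),
   so that phi (t, X t; Y t) is a random variable. *)
Definition test_function (R : realType) (T : R) (n p : nat)
    (phi : R -> 'cV[R]_n -> 'cV[R]_p -> R) : Prop :=
  (forall y, Cb12 T (fun t x => phi t x y)) /\
  (forall t : R, t \in `[0, T] ->
     measurable_fun
       [set: g_sigma_algebraType (@open ('cV[R]_n * 'cV[R]_p)%type)]
       (fun z : g_sigma_algebraType (@open ('cV[R]_n * 'cV[R]_p)%type) =>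
          phi t z.1 z.2)).

(* Main.v *)
Require Import Defs.
From mathcomp Require Import ring.

(** No stochastic calculus is involved: on [F t] the measure [Pbar] has the
    positive density [chibar] with respect to [Ph], so that
    [int_A Z dPh = int_A Z * PsiX dPbar] for every [F t]-measurable [Z >= 0] and
    every [A] in [F t].  Let [V] be a version of [E^h[Z | G]], [U] of
    [Ebar[Z PsiX | G]] and [M] of [Ebar[PsiX | G]], where [G] is [F^Y_t].  For
    [A] in [G], pulling [V] out of the conditional expectation gives
    [int_A U dPbar = int_A V dPh = int_A V * PsiX dPbar = int_A V * M dPbar],
    hence [U = V * M] almost surely, with [0 < M < +oo].  This is applied to the
    positive and negative parts of [phi * exp_cost]; nothing is integrable a
    priori, so uniqueness of conditional expectations is needed for
    [[0, +oo]]-valued functions.  The remaining work is [F t]-measurability of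
    [phi (t, X t; Y t)], [exp_cost], [chi] and [chibar]. *)

Set Implicit Arguments.
Unset Strict Implicit.
Unset Printing Implicit Defensive.

Local Open Scope classical_set_scope.
Local Open Scope ring_scope.

(** * Change of measure *)

Section change_of_measure.
Context {R : realType} {d : measure_display} {Omega : measurableType d}.
Implicit Types (P Q : probability Omega R) (G H : set (set Omega)).

Lemma measurable_wrtW G H d' (U : measurableType d') (f : Omega -> U) :
  G `<=` H -> measurable_wrt G f -> measurable_wrt H f.
Proof.
by move=> GH mf _ B mB; apply: (sub_sigma_algebra2 GH); exact: mf.
Qed.

Lemma measurable_wrtP G d' (U : measurableType d') (f : Omega -> U) B :
  sigma_algebra [set: Omega] G -> measurable_wrt G f -> measurable B ->
  G (f @^-1` B).
Proof.
move=> sG mf mB; have := mf measurableT _ mB.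
by rewrite setTI /measurable/= sigma_algebra_id.
Qed.

Lemma measurable_wrt_measurable H d' (U : measurableType d') (f : Omega -> U) :
  H `<=` measurable -> measurable_wrt H f -> measurable_fun setT f.
Proof.
move=> Hm mf _ B mB; have : <<s measurable >> (setT `&` f @^-1` B).
  by apply: (sub_sigma_algebra2 Hm); exact: mf.
by rewrite sigma_algebra_id//; exact: sigma_algebra_measurable.
Qed.

Import HBNNSimple.

(** The relation between [Q'] and [Q] is known only on [H], so the approximating simple functions
    must be [H]-measurable. The identity holds on indicators of sets of [H], extends by linearity to
    simple functions and by monotone convergence to [f]. *)
Lemma integral_density Q Q' H (D : Omega -> R) (f : Omega -> \bar R) :
  sigma_algebra [set: Omega] H -> H `<=` measurable ->
  (forall w, 0 <= D w) -> measurable_wrt H D ->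
  (forall A, H A -> Q' A = (\int[Q]_(w in A) (D w)%:E)%E) ->
  (forall w, 0 <= f w)%E -> measurable_wrt H f ->
  (\int[Q']_w f w = \int[Q]_w (f w * (D w)%:E))%E.
Proof.
move=> sH Hm D0 mD Q'E f0 mf.
have mD' := measurable_wrt_measurable Hm mD.
have simple (g : {nnsfun (g_sigma_algebraType H) >-> R}) :
    (\int[Q']_w (g w)%:E = \int[Q]_w ((g w)%:E * (D w)%:E))%E.
  (* Level sets belong to [H], where [Q'E] evaluates [Q'] through the density. *)
  have Hg y : H (g @^-1` [set y]).
    exact: (measurable_wrtP sH (measurable_funPT g) (measurable_set1 y)).
  have mg y : measurable (g @^-1` [set y] : set Omega) by apply/Hm/Hg.
  have m1 y : measurable_fun setT
      (fun w : Omega => (y * \1_(g @^-1` [set y]) w)%:E).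
    by apply/measurable_EFinP/measurable_funM => //; exact: measurable_indic.
  transitivity (\int[Q']_w
     (\sum_(y \in range g) (y * \1_(g @^-1` [set y]) w)%:E))%E.
    by apply: eq_integral => w _; rewrite fimfunE -fsumEFin.
  rewrite ge0_integral_fsum//; last by move=> y w _; exact: nnfun_muleindic_ge0.
  transitivity (\int[Q]_w
     (\sum_(y \in range g) ((y * \1_(g @^-1` [set y]) w)%:E * (D w)%:E)))%E;
      last first.
    apply: eq_integral => w _; rewrite -ge0_mule_fsuml; last first.
      by move=> y; exact: nnfun_muleindic_ge0.
    by rewrite fsumEFin// -fimfunE.
  rewrite ge0_integral_fsum//; last 2 first.
  - by move=> y; apply: emeasurable_funM => //; exact/measurable_EFinP.
  - by move=> y w _; rewrite mule_ge0 ?nnfun_muleindic_ge0 ?lee_fin.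
  apply: eq_fsbigr => y; rewrite inE => -[w _ <-].
  have gw0 : (0 <= g w)%R by [].
  under eq_integral do rewrite EFinM.
  rewrite ge0_integralZl//; last exact/measurable_EFinP/measurable_indic.
  rewrite integral_indic// setIT.
  transitivity ((g w)%:E * \int[Q]_(v in g @^-1` [set g w]) (D v)%:E)%E.
    by congr (_ * _)%E; exact: Q'E.
  under [RHS]eq_integral do rewrite EFinM -muleA.
  rewrite ge0_integralZl//; last 2 first.
  - by apply: emeasurable_funM; apply/measurable_EFinP.
  - by move=> v _; rewrite mule_ge0 ?lee_fin.
  congr (_ * _)%E; rewrite [LHS]integral_mkcond; apply: eq_integral => v _.
  by rewrite epatch_indic muleC.
pose h := nnsfun_approx (measurableT : measurable [set: g_sigma_algebraType H]) mf.
have hf w : (h n w)%:E @[n --> \oo] --> f w.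
  exact: (@cvg_nnsfun_approx _ _ _ _ _ _ mf (fun x _ => f0 x)).
have hnd w : {homo (fun n => h n w) : m n / (m <= n)%N >-> (m <= n)%R}.
  by move=> m n mn; exact/lefP/nd_nnsfun_approx.
have mh n : measurable_fun setT (h n : Omega -> R).
  exact: (measurable_wrt_measurable Hm (measurable_funPT (h n))).
have -> : (\int[Q']_w f w = \int[Q']_w limn (fun n => (h n w)%:E))%E.
  by apply: eq_integral => w _; apply/esym/cvg_lim.
have -> : (\int[Q]_w (f w * (D w)%:E)
           = \int[Q]_w limn (fun n => (h n w)%:E * (D w)%:E))%E.
  by apply: eq_integral => w _; apply/esym/cvg_lim => //; exact: cvgeZr.
rewrite !monotone_convergence//.
- by congr (limn _); apply/funext => n; exact: simple.
- by move=> n; apply: emeasurable_funM; exact/measurable_EFinP.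
- by move=> n w _; rewrite mule_ge0 ?lee_fin.
- by move=> w _ m n mn; rewrite lee_wpmul2r ?lee_fin ?hnd.
- by move=> n; exact/measurable_EFinP.
- by move=> n w _; rewrite lee_fin.
- by move=> w _ m n mn; rewrite lee_fin hnd.
Qed.

End change_of_measure.

(** * Uniqueness of nonnegative conditional expectations *)

Section uniqueness.
Context {R : realType} {d : measure_display} {Omega : measurableType d}.
Implicit Types (P Q : probability Omega R) (G H : set (set Omega)).

Lemma g_measurableE G (A : set Omega) : sigma_algebra [set: Omega] G ->
  measurable (A : set (g_sigma_algebraType G)) = G A.
Proof. by move=> sG; rewrite /measurable/= sigma_algebra_id. Qed.

(** Two rationals, rather than one, leave a strict gap between the bounds; this gap produces the
    contradiction in [integral_lt_null]. The value [y] may be [+oo]. *)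
Lemma ereal_lt_ratr (x y : \bar R) : (0 <= x)%E -> (x < y)%E ->
  exists q r : rat, [/\ (x <= (ratr q)%:E)%E, (ratr q : R) < ratr r
                      & ((ratr r)%:E <= y)%E].
Proof.
move=> x0 xy; have xf : x \is a fin_num.
  by rewrite ge0_fin_numE// (lt_le_trans xy)// leey.
move: x xf x0 xy => [x| |]// _ _ xy.
have [z xz zy] : exists2 z, x < z & (z%:E <= y)%E.
  case: y xy => [y| |]//= xy; first by exists y.
  by exists (x + 1); rewrite ?ltrDl ?leey.
have [q] := rat_in_itvoo xz; rewrite in_itv/= => /andP[xq qz].
have [r] := rat_in_itvoo qz; rewrite in_itv/= => /andP[qr rz].
exists q, r; split => //; first by rewrite lee_fin ltW.
by rewrite (le_trans _ zy)// lee_fin ltW.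
Qed.

(** Integrals may be infinite, so [f - g] cannot be integrated. Instead the event is covered by
    countably many sets of [G] on which [g] is bounded by a rational, hence has finite integral. *)
Lemma integral_lt_null Q G (f g : Omega -> \bar R) :
  sigma_algebra [set: Omega] G -> G `<=` measurable ->
  measurable_wrt G f -> measurable_wrt G g -> (forall w, 0 <= f w)%E ->
  (forall w, 0 <= g w)%E ->
  (forall A, G A -> (\int[Q]_(w in A) f w = \int[Q]_(w in A) g w)%E) ->
  Q [set w | (g w < f w)%E] = 0%E.
Proof.
move=> sG Gm mf mg f0 g0 fg.
(* On [A (q, r)], [r * Q A <= int_A f = int_A g <= q * Q A] although [q < r]. *)
pose A (qr : rat * rat) : set Omega :=
  if (ratr qr.1 : R) < ratr qr.2 then
    [set w | (g w <= (ratr qr.1)%:E)%E] `&` [set w | ((ratr qr.2)%:E <= f w)%E]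
  else set0.
have GA qr : G (A qr).
  rewrite -g_measurableE// /A; case: ifPn => // _; apply: measurableI.
    by rewrite -[X in measurable X]setTI; exact: emeasurable_fun_infty_c.
  by rewrite -[X in measurable X]setTI; exact: emeasurable_fun_c_infty.
have A0 qr : Q (A qr) = 0%E.
  have := GA qr; rewrite /A; case: ifPn => [lt_qr|]; last by rewrite measure0.
  set B := _ `&` _ => GB; have mB := Gm _ GB.
  have mf' := measurable_wrt_measurable Gm mf.
  have mg' := measurable_wrt_measurable Gm mg.
  have := fg _ GB.
  have mfB : measurable_fun B f by exact: measurable_funTS.
  have mgB : measurable_fun B g by exact: measurable_funTS.
  have lower : ((ratr qr.2 : R)%:E * Q B <= \int[Q]_(w in B) f w)%E.
    rewrite -(integral_cst Q mB); apply: ge0_le_integral => //.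
    - move=> w [/= gq _]; rewrite (le_trans (g0 w))// (le_trans gq)//.
      by rewrite lee_fin ltW.
    - by move=> w [].
  have upper : (\int[Q]_(w in B) g w <= (ratr qr.1 : R)%:E * Q B)%E.
    by rewrite -(integral_cst Q mB); apply: ge0_le_integral => // w [].
  move=> fgB; move: lower; rewrite fgB => /le_trans/(_ upper).
  have QB : Q B \is a fin_num by exact: fin_num_measure.
  rewrite -(fineK QB) -!EFinM lee_fin => le_qr; congr EFin.
  apply/eqP; rewrite eq_le fine_ge0// andbT leNgt; apply/negP => QB0.
  by move: le_qr; rewrite ler_pM2r// leNgt lt_qr.
apply: measure_negligible.
  rewrite -[X in measurable X]setTI.
  by apply: measurable_lte => //; exact: (measurable_wrt_measurable Gm).
apply: (@negligibleS _ _ _ _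
    (\bigcup_n (if unpickle n is Some qr then A qr else set0))).
  move=> w /(ereal_lt_ratr (g0 w))[q [r [gq qr rf]]].
  by exists (pickle (q, r)); [exact: Logic.I|rewrite pickleK /A/= qr].
apply: negligible_bigcup => n; case: unpickle => [qr|]; last first.
  exact: negligible_set0.
by apply/negligibleP; [exact/Gm/GA|exact: A0].
Qed.

(** Membership in [G] is recorded along with nullity because exceptional sets are later carried from
    one measure to another, and the measures are related only on a sub-sigma-algebra. *)
Lemma integral_eq_null Q G (f g : Omega -> \bar R) :
  sigma_algebra [set: Omega] G -> G `<=` measurable ->
  measurable_wrt G f -> measurable_wrt G g -> (forall w, 0 <= f w)%E ->
  (forall w, 0 <= g w)%E ->
  (forall A, G A -> (\int[Q]_(w in A) f w = \int[Q]_(w in A) g w)%E) ->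
  G [set w | f w != g w] /\ Q [set w | f w != g w] = 0%E.
Proof.
move=> sG Gm mf mg f0 g0 fg; split.
  by rewrite -g_measurableE// -[X in measurable X]setTI; exact: measurable_neqe.
have mf' := measurable_wrt_measurable Gm mf.
have mg' := measurable_wrt_measurable Gm mg.
have lt_null u v : measurable_fun setT u -> measurable_fun setT v ->
    Q [set w | (u w < v w)%E] = 0%E -> Q.-negligible [set w | (u w < v w)%E].
  move=> mu mv ?; apply/negligibleP => //.
  by rewrite -[X in measurable X]setTI; exact: measurable_lte.
apply: measure_negligible.
  by rewrite -[X in measurable X]setTI; exact: measurable_neqe.
rewrite set_neq_lt; apply: negligibleU; apply: lt_null => //.
  by apply: (@integral_lt_null Q G) => // A /fg.
exact: (@integral_lt_null Q G).
Qed.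

End uniqueness.

(** * Bayes' formula *)

Lemma measurable_wrt_patch (R : realType) (d : measure_display)
    (Omega : measurableType d) (G : set (set Omega)) A (f : Omega -> \bar R) :
  sigma_algebra [set: Omega] G -> G A -> measurable_wrt G f ->
  measurable_wrt G (f \_ A).
Proof.
move=> sG GA mf.
have mA : measurable (A : set (g_sigma_algebraType G)) by rewrite g_measurableE.
by apply: (proj1 (measurable_restrictT _ mA)); exact: measurable_funTS.
Qed.

Section bayes.
Context {R : realType} {d : measure_display} {Omega : measurableType d}.
Variables (Q Q' : probability Omega R) (G H : set (set Omega)) (D : Omega -> R).
Hypotheses (sG : sigma_algebra [set: Omega] G).
Hypotheses (sH : sigma_algebra [set: Omega] H).
Hypotheses (GH : G `<=` H) (Hm : H `<=` measurable).
Hypotheses (D0 : forall w, 0 < D w) (mD : measurable_wrt H D).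
Hypothesis Q'E : forall A, H A -> Q' A = (\int[Q]_(w in A) (D w)%:E)%E.

Lemma measurable_wrt_invr : measurable_wrt H (fun w => (D w)^-1).
Proof.
(* Positivity of [D] turns the inverse into a composition of measurable functions. *)
suff -> : (fun w => (D w)^-1) = (fun w => expR (- ln (D w))).
  apply: measurableT_comp => //; apply: measurableT_comp => //.
  by apply: measurableT_comp => //; exact: measurable_ln.
by apply/funext => w; rewrite expRN lnK ?posrE.
Qed.

(** Since [D] is positive, it cancels against its inverse: on [H], [Q] has density [1/D] with
    respect to [Q']. *)
Lemma integral_density_inv A (f : Omega -> \bar R) : H A ->
  (forall w, 0 <= f w)%E -> measurable_wrt H f ->
  (\int[Q']_(w in A) (f w * ((D w)^-1)%:E) = \int[Q]_(w in A) f w)%E.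
Proof.
move=> HA f0 mf; rewrite integral_mkcond [RHS]integral_mkcond.
have D0' w : 0 <= D w by exact: ltW.
rewrite (integral_density (H := H) (Q := Q) (D := D))//.
- apply: eq_integral => w _; rewrite !patchE; case: ifPn; last by rewrite mul0e.
  by rewrite -muleA -EFinM mulVf ?mule1// gt_eqF.
- move=> w; rewrite patchE; case: ifPn => // _.
  by rewrite mule_ge0// lee_fin invr_ge0.
- apply: measurable_wrt_patch => //; apply: emeasurable_funM => //.
  by apply/measurable_EFinP; exact: measurable_wrt_invr.
Qed.

(** Taking [f = 1] in [integral_density_inv] writes [Q A] as a [Q']-integral over a [Q']-null
    set. *)
Lemma density_null A : H A -> Q' A = 0%E -> Q A = 0%E.
Proof.
move=> HA A0; have mA := Hm HA.
have := @integral_density_inv A (cst 1%E) HA (fun=> lee01)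
  (@measurable_cst _ _ _ _ _ _).
rewrite integral_cst// mul1e => <-.
apply: null_set_integral => //; apply: measurable_funTS.
apply: emeasurable_funM => //; apply/measurable_EFinP.
exact: (measurable_wrt_measurable Hm measurable_wrt_invr).
Qed.

Let Gm : G `<=` measurable. Proof. exact: subset_trans Hm. Qed.

Section condexp.
Variable M : Omega -> \bar R.
Hypothesis hM : is_condexp_ge0 Q' G (fun w => ((D w)^-1)%:E) M.

(** Conditioning [1/D] on [G] yields the density of [Q] with respect to [Q'] on the smaller
    sigma-algebra [G]. *)
Lemma integral_condexp_density A : G A -> (Q A = \int[Q']_(w in A) M w)%E.
Proof.
have [mM M0 ME] := hM => GA; rewrite ME//.
transitivity (\int[Q]_(w in A) (cst 1%E w))%E.
  by rewrite integral_cst ?mul1e//; exact: Gm.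
rewrite -integral_density_inv//; last 2 first.
- exact: GH.
- exact: measurable_cst.
by apply: eq_integral => w _; rewrite mul1e.
Qed.

(** Otherwise the density [M] would give the event infinite [Q]-measure, although [Q] is a
    probability. *)
Lemma condexp_density_pinfty :
  G [set w | M w = +oo%E] /\ Q' [set w | M w = +oo%E] = 0%E.
Proof.
have [mM M0 ME] := hM.
have GA : G [set w | M w = +oo%E].
  rewrite -g_measurableE// -[X in measurable X]setTI.
  by apply: measurable_eqe => //; exact: measurable_cst.
split => //; apply/eqP; rewrite eq_le measure_ge0 andbT leNgt; apply/negP => A0.
have := integral_condexp_density GA.
rewrite (eq_integral (cst +oo%E)); last by move=> w; rewrite inE.
rewrite integral_cst ?gt0_mulye//; last exact: Gm.
move=> QA; have : Q [set w | M w = +oo%E] \is a fin_num.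
  by exact: (fin_num_measure Q _ (Gm GA)).
by rewrite QA.
Qed.

Lemma condexp_density_eq0 :
  G [set w | M w = 0%E] /\ Q [set w | M w = 0%E] = 0%E.
Proof.
have [mM M0 ME] := hM.
have GA : G [set w | M w = 0%E].
  rewrite -g_measurableE// -[X in measurable X]setTI.
  by apply: measurable_eqe => //; exact: measurable_cst.
split => //; rewrite integral_condexp_density//.
by apply: integral0_eq => w.
Qed.

(** Both sides have the same [Q']-integral over every set of [G]: once through the density [1/D] on
    [H], once through the density [M] on [G]. *)
Lemma condexp_bayes_ge0 (Z : Omega -> R) (V U : Omega -> \bar R) :
  measurable_wrt H Z -> (forall w, 0 <= Z w) ->
  is_condexp_ge0 Q G (EFin \o Z) V ->
  is_condexp_ge0 Q' G (fun w => (Z w / D w)%:E) U ->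
  G [set w | U w != V w * (fine (M w))%:E]%E /\
  Q' [set w | U w != V w * (fine (M w))%:E]%E = 0%E.
Proof.
have [mM M0 ME] := hM => mZ Z0 [mV V0 VE] [mU U0 UE].
have mfM : measurable_wrt G (fine \o M).
  by apply: measurableT_comp => //; exact: fine_measurable.
have fM0 w : 0 <= fine (M w) by rewrite fine_ge0.
have mVM : measurable_wrt G (fun w => V w * (fine (M w))%:E)%E.
  by apply: emeasurable_funM => //; exact/measurable_EFinP.
(* [fine] sends [+oo] to [0], which changes [M] only on a [Q']-null event, so [fine \o M] is a
   real-valued density of [Q] on [G], as [integral_density] requires. *)
have QE A : G A -> Q A = (\int[Q']_(w in A) (fine (M w))%:E)%E.
  move=> GA; rewrite integral_condexp_density//.
  have [GN N0] := condexp_density_pinfty.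
  apply: ge0_ae_eq_integral => //; first exact: Gm.
  - by apply: measurable_funTS; exact: (measurable_wrt_measurable Gm mM).
  - apply/measurable_EFinP; apply: measurable_funTS.
    exact: (measurable_wrt_measurable Gm mfM).
  - by move=> w _; rewrite lee_fin.
  - exists [set w | M w = +oo%E]; split => //; first exact: Gm.
    move=> w /= /not_implyP[_]; have := M0 w; case: (M w) => //=.
apply: integral_eq_null => //.
  by move=> w; rewrite mule_ge0 ?lee_fin.
move=> A GA; rewrite UE//.
under eq_integral do rewrite EFinM.
rewrite integral_density_inv//; last 2 first.
  exact: GH.
  exact/measurable_EFinP.
rewrite -VE// integral_mkcond [RHS]integral_mkcond.
rewrite (integral_density (H := G) (Q := Q') (D := fine \o M))//.
- by apply: eq_integral => w _; rewrite !patchE; case: ifPn; rewrite ?mul0e.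
- by move=> w; rewrite patchE; case: ifPn.
- exact: measurable_wrt_patch.
Qed.

End condexp.

(** The nonnegative case applies to the positive and negative parts of [Z], because dividing by
    [D > 0] commutes with taking these parts. Outside a null set [M] is a positive real, and
    dividing by it respects differences, including the convention that [+oo - +oo] is [-oo]. *)
Lemma condexp_bayes (Z : Omega -> R) (V U M : Omega -> \bar R) :
  measurable_wrt H Z ->
  is_condexp Q G Z V -> is_condexp Q' G (fun w => Z w / D w) U ->
  is_condexp Q' G (fun w => (D w)^-1) M ->
  exists N, [/\ G N, Q N = 0%E & forall w, ~ N w -> V w = (U w / M w)%E].
Proof.
move=> mZ [Vp [Vn [hVp hVn VE]]] [Up [Un [hUp hUn UE]]].
move=> [Mp [Mn [hMp hMn ME]]].
have Di0 w : 0 < (D w)^-1 by rewrite invr_gt0.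
have hMp' : is_condexp_ge0 Q' G (fun w => ((D w)^-1)%:E) Mp.
  case: hMp => mM M0 MpE; split => // A GA; rewrite MpE//.
  by apply: eq_integral => w _; rewrite max_l// ltW.
(* The negative part of [1/D] vanishes, hence so does its conditional expectation, almost surely. *)
have [GMn Mn0] : G [set w | Mn w != 0%E] /\ Q' [set w | Mn w != 0%E] = 0%E.
  case: hMn => mM M0 MnE.
  apply: (@integral_eq_null _ _ _ Q' G Mn (cst 0%E)) => //.
    exact: measurable_cst.
  move=> A GA; rewrite MnE//; apply: eq_integral => w _.
  by rewrite max_r ?oppr_le0 ?ltW.
have mN : measurable_wrt H (fun w => - Z w) by exact: measurableT_comp.
have mpos (X : Omega -> R) : measurable_wrt H X ->
    measurable_wrt H (fun w => Num.max (X w) 0).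
  by move=> mX; apply: measurable_maxr => //; exact: measurable_cst.
have max0 (X : Omega -> R) w : 0 <= Num.max (X w) 0 by rewrite le_max lexx orbT.
have [GUp Up0] : G [set w | Up w != Vp w * (fine (Mp w))%:E]%E /\
                Q' [set w | Up w != Vp w * (fine (Mp w))%:E]%E = 0%E.
  apply: (@condexp_bayes_ge0 _ hMp' (fun w => Num.max (Z w) 0)) => //.
    exact: mpos.
  case: hUp => mU U0 UpE; split => // A GA; rewrite UpE//.
  by apply: eq_integral => w _; rewrite maxr_pMl ?mul0r// ltW.
have [GUn Un0] : G [set w | Un w != Vn w * (fine (Mp w))%:E]%E /\
                Q' [set w | Un w != Vn w * (fine (Mp w))%:E]%E = 0%E.
  apply: (@condexp_bayes_ge0 _ hMp' (fun w => Num.max (- Z w) 0)) => //.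
  - exact: (mpos (fun v => - Z v)).
  - by move=> w; exact: (max0 (fun v => - Z v)).
  case: hUn => mU U0 UnE; split => // A GA; rewrite UnE//.
  by apply: eq_integral => w _; rewrite -mulNr maxr_pMl ?mul0r// ltW.
have [GMy My0] := condexp_density_pinfty hMp'.
have [GM0 M00] := condexp_density_eq0 hMp'.
pose S := [:: [set w | Mn w != 0%E];
  [set w | Up w != Vp w * (fine (Mp w))%:E]%E;
  [set w | Un w != Vn w * (fine (Mp w))%:E]%E; [set w | Mp w = +oo%E];
  [set w | Mp w = 0%E]].
have GS A : A \in S -> G A.
  by rewrite !inE => /or4P[| | |/orP[]] /eqP ->.
(* The event where [Mp] is [0] is [Q]-null already; the other four are [Q']-null and pass to [Q] by
   [density_null]. *)
have S0 A : A \in S -> Q A = 0%E.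
  by rewrite !inE => /or4P[| | |/orP[]] /eqP -> //; apply: density_null => //;
    exact: GH.
exists (\big[setU/set0]_(A <- S) A); split.
- rewrite -g_measurableE// big_seq; apply: bigsetU_measurable => A /GS.
  by rewrite g_measurableE.
- apply: measure_negligible.
    by rewrite big_seq; apply: bigsetU_measurable => A /GS /Gm.
  rewrite big_seq; elim/big_ind: _ => [|A B|A AS].
  + exact: negligible_set0.
  + exact: negligibleU.
  + by apply/negligibleP; [exact/Gm/GS|exact: S0].
move=> w; rewrite !big_cons big_nil setU0 /= => /not_orP[/negP].
rewrite negbK => /eqP Mnw /not_orP[/negP]; rewrite negbK => /eqP Upw.
move=> /not_orP[/negP]; rewrite negbK => /eqP Unw /not_orP[Mpy Mp0].
rewrite VE UE ME Mnw Upw Unw sube0.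
have [_ /(_ w) Mpw _] := hMp'.
move: Mpw Mpy Mp0; case: (Mp w) => [r| |]//= r0 _ r_neq0.
have {r_neq0} r_neq0 : r != 0 by apply/eqP => rE; apply: r_neq0; rewrite rE.
have r_gt0 : 0 < r by rewrite lt_def r_neq0 -lee_fin.
rewrite inver (negbTE r_neq0).
have [_ /(_ w) Vp0 _] := hVp; have [_ /(_ w) Vn0 _] := hVn.
(* Each of [Vp w] and [Vn w] is a real or [+oo]; when both are infinite, both sides equal [-oo]. *)
case: (Vp w) (Vn w) Vp0 Vn0 => [p| |]// [q| |]// _ _.
- by rewrite -[RHS]/(((p * r - q * r) / r)%:E) -EFinB; congr EFin; field.
- by rewrite gt0_mulye ?lte_fin// addeNy gt0_mulNye// lte_fin invr_gt0.
- by rewrite gt0_mulye ?lte_fin// addye// gt0_mulye// lte_fin invr_gt0.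
- by rewrite gt0_mulye ?lte_fin//= addeNy gt0_mulNye// lte_fin invr_gt0.
Qed.
End bayes.

(** * Joint measurability of processes *)

Section open_preimage.
Context {R : realType} {d : measure_display} {S : measurableType d}.
Variable (D : set S).
Hypothesis mD : measurable D.

(** Separability makes an open set the union of the countably many balls it contains that have a
    centre in the dense family and a radius of the form [1/(N+1)]. *)
Lemma measurable_preimage_open (U : pseudoMetricType R) (K : countType)
    (q : K -> U) (f : S -> U) :
  (forall x e, 0 < e -> exists k, ball x e (q k)) ->
  (forall k e, 0 < e -> measurable (D `&` [set s | ball (q k) e (f s)])) ->
  forall O : set U, open O -> measurable (D `&` f @^-1` O).
Proof.
move=> q_dense mball O oO.
pose A (kN : K * nat) := if `[< ball (q kN.1) (kN.2.+1%:R^-1 : R) `<=` O >]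
  then D `&` [set s | ball (q kN.1) kN.2.+1%:R^-1 (f s)] else set0.
have -> : D `&` f @^-1` O = \bigcup_kN A kN.
  apply/seteqP; split => [s [Ds Ofs]|s [kN _]]; last first.
    by rewrite /A; case: ifPn => // /asboolP sub [Ds /sub].
  have /nbhs_ballP[e e0 eO] : nbhs (f s) O by exact: open_nbhs_nbhs.
  (* With radius below [e / 2], the ball about a dense point near [f s] contains [f s] and stays in
     the [e]-ball about [f s]. *)
  have [N Ne] : exists N : nat, (N.+1%:R^-1 : R) < e / 2.
    exists (Num.truncn (e / 2)^-1); rewrite invf_plt ?posrE ?divr_gt0//.
    exact: truncnS_gt.
  have [k fk] := q_dense (f s) (N.+1%:R^-1 : R) ltac:(by rewrite invr_gt0).
  exists (k, N); first exact: Logic.I.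
  rewrite /A/=; case: asboolP => [_|[]]; first by split => //=; exact: ball_sym.
  move=> y ky; apply: eO; rewrite (splitr e).
  apply: ball_triangle; apply: le_ball (ltW Ne) _ _; last exact: ky.
  exact: fk.
apply: countable_bigcupT_measurable => // -[k N]; rewrite /A/=.
by case: ifPn => // _; apply: mball; rewrite invr_gt0.
Qed.

(** Balls of matrices are entrywise, so the complement is a finite union of events on single
    entries. *)
Lemma measurable_ball_mx n p (X : S -> 'M[R]_(n, p)) :
  (forall i j, measurable_fun D (fun s => X s i j)) ->
  forall A e, 0 < e -> measurable (D `&` [set s | ball A e (X s)]).
Proof.
move=> mX A e e0.
have -> : D `&` [set s | ball A e (X s)] =
    D `\` \bigcup_(ij : 'I_n * 'I_p)
      (D `&` (fun s => X s ij.1 ij.2) @^-1` (~` ball (A ij.1 ij.2) e)).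
  apply/seteqP; split => s [Ds].
    by move=> [_ Xs]; split => // -[[i j] _ [_ /=]]; apply; exact: Xs.
  move=> Xs; split => //; split => // i j; apply: contrapT => Xij.
  by apply: Xs; exists (i, j).
apply: measurableD => //; apply: countable_bigcupT_measurable => // -[i j].
by apply: mX => //; apply: measurableC; exact: measurable_ball.
Qed.

Lemma rat_ball (x e : R) : 0 < e -> exists q : rat, ball x e (ratr q).
Proof.
move=> e0; have [q] : exists q, ratr q \in `]x - e, x + e[%R.
  by apply: rat_in_itvoo; rewrite ltrBlDr -addrA ltrDl addr_gt0.
by rewrite in_itv/= => xq; exists q; rewrite ball_itv/= in_itv.
Qed.

Lemma rat_ball_mx n p (A : 'M[R]_(n, p)) (e : R) : 0 < e ->
  exists q : 'M[rat]_(n, p), ball A e (map_mx ratr q).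
Proof.
move=> e0; have /choice[q qA] (ij : 'I_n * 'I_p) :
  exists q : rat, ball (A ij.1 ij.2) e (ratr q) by exact: rat_ball.
exists (\matrix_(i, j) q (i, j)); split => // i j; rewrite !mxE.
exact: (qA (i, j)).
Qed.

(** Points with rational coordinates are dense, and a ball of the product is a product of balls. *)
Lemma measurable_preimage_open_mx n p (r : S -> R) (X : S -> 'cV[R]_n)
    (Y : S -> 'cV[R]_p) (O : set (R * ('cV[R]_n * 'cV[R]_p))) :
  measurable_fun D r -> (forall i j, measurable_fun D (fun s => X s i j)) ->
  (forall i j, measurable_fun D (fun s => Y s i j)) -> open O ->
  measurable (D `&` [set s | O (r s, (X s, Y s))]).
Proof.
move=> mr mX mY; pose f s := (r s, (X s, Y s)).
pose q (k : rat * ('cV[rat]_n * 'cV[rat]_p)) : R * ('cV[R]_n * 'cV[R]_p) :=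
  (ratr k.1, (map_mx ratr k.2.1, map_mx ratr k.2.2)).
apply: (@measurable_preimage_open _ _ q f).
  move=> [x [y z]] e e0; have [qx xq] := rat_ball x e0.
  have [qy yq] := rat_ball_mx y e0; have [qz zq] := rat_ball_mx z e0.
  by exists (qx, (qy, qz)).
move=> [qx [qy qz]] e e0.
have -> : D `&` [set s | ball (q (qx, (qy, qz))) e (f s)] =
    (D `&` r @^-1` ball (ratr qx : R) e) `&`
    ((D `&` [set s | ball (map_mx ratr qy : 'cV[R]_n) e (X s)]) `&`
     (D `&` [set s | ball (map_mx ratr qz : 'cV[R]_p) e (Y s)])).
  by apply/seteqP; split => s; [move=> [Ds [? [? ?]]]|move=> [[Ds ?] [[_ ?] [_ ?]]]].
apply: measurableI; first by apply: mr => //; exact: measurable_ball.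
by apply: measurableI; exact: measurable_ball_mx.
Qed.

End open_preimage.

(** * Joint measurability in time and outcome, and time integrals *)

Section joint.
Context {R : realType} {d : measure_display} {Omega : measurableType d}.
Variables (H : set (set Omega)) (t : R).

Local Notation M := (g_sigma_algebraType H).

(** For [H = F t] this is the condition at time [t] in [progressive], stated for a scalar
    process. *)
Definition jointly_measurable (f : R -> Omega -> R) : Prop :=
  measurable_fun (`[0, t] `*` [set: M]) (fun z : R * M => f z.1 z.2).

Let mD : measurable (`[0, t] `*` [set: M] : set (R * M)).
Proof. by apply: measurableX => //; exact: measurable_itv. Qed.

Lemma measurable_wrt_integral (f : R -> Omega -> \bar R) :
  (forall s w, 0 <= f s w)%E ->
  measurable_fun (`[0, t] `*` [set: M]) (fun z : R * M => f z.1 z.2) ->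
  measurable_wrt H (fun w => \int[lebesgue_measure]_(s in `[0%R, t]) f s w)%E.
Proof.
move=> f0 mf.
(* Extension by zero outside the time interval makes the integral a section integral, to which
   Tonelli's theorem applies. *)
have mfD : measurable_fun setT
    ((fun z : R * M => f z.1 z.2) \_ (`[0, t] `*` [set: M])).
  exact: (proj1 (measurable_restrictT _ mD)).
have fD0 z :
    (0 <= ((fun z : R * M => f z.1 z.2) \_ (`[0%R, t] `*` [set: M])) z)%E.
  by rewrite patchE; case: ifPn.
have := measurable_fun_fubini_tonelli_G (m1 := @lebesgue_measure R) _ mfD fD0.
rewrite /measurable_wrt; congr (measurable_fun _ _); apply/funext => w.
rewrite /fubini_G [RHS]integral_mkcond; apply: eq_integral => s _.
rewrite !patchE; congr (if _ then _ else _).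
by apply/idP/idP; rewrite !inE; [case|].
Qed.

(** The real integral is [fine] of a difference of two extended integrals of nonnegative functions;
    each operation is measurable even where an integral is infinite. *)
Lemma measurable_wrt_Rintegral (f : R -> Omega -> R) : jointly_measurable f ->
  measurable_wrt H (fun w => \int[lebesgue_measure]_(s in `[0, t]) f s w).
Proof.
move=> mf; rewrite /Rintegral.
apply: (measurableT_comp (f := @fine R)); first exact: fine_measurable.
under eq_fun do rewrite integralE.
have mfE : measurable_fun (`[0, t] `*` [set: M])
  (fun z : R * M => (f z.1 z.2)%:E) by exact/measurable_EFinP.
apply: emeasurable_funB.
  apply: (@measurable_wrt_integral (fun s w => (fun s => (f s w)%:E)^\+ s)%E).
    by move=> s w; exact: funepos_ge0.
  by move: (measurable_funepos mfE); rewrite funepos.unlock.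
apply: (@measurable_wrt_integral (fun s w => (fun s => (f s w)%:E)^\- s)%E).
  by move=> s w; exact: funeneg_ge0.
by move: (measurable_funeneg mfE); rewrite funeneg.unlock.
Qed.

(** The process is the pointwise limit of its values at grid times; on each time strip of the grid
    the approximation is a single random variable. *)
Lemma continuous_jointly_measurable (Z : R -> Omega -> R) :
  (forall s, s \in `[0, t] -> measurable_wrt H (Z s)) ->
  (forall w, {within `[0, t], continuous (fun s => Z s w)}) ->
  jointly_measurable Z.
Proof.
move=> mZ cZ.
(* Rounding down keeps the grid time in [[0, t]], where [Z] is measurable with respect to [H] and
   its paths are continuous. *)
pose r (N : nat) (s : R) : R := (Num.truncn (s * N.+1%:R))%:R / N.+1%:R.
have r_le N s : 0 <= s -> 0 <= r N s <= s.
  move=> s0; rewrite divr_ge0//= ler_pdivrMr//.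
  by rewrite truncn_le// mulr_ge0.
have r_lt N s : 0 <= s -> s < r N s + N.+1%:R^-1.
  move=> s0; rewrite -[X in _ + X]mul1r -mulrDl ltr_pdivlMr//.
  by rewrite natr1 truncnS_gt.
apply: (@measurable_fun_cvg _ _ _ _ (fun N (z : R * M) => Z (r N z.1) z.2)).
- move=> N.
  pose E k : set (R * M) :=
    (`[0, t] `&` `[k%:R / N.+1%:R, k.+1%:R / N.+1%:R[) `*` [set: M].
  have DE : `[0, t] `*` [set: M] = \bigcup_k E k.
    apply/seteqP; split => [[s w] [/= st _]|z [k _] [[]]]//.
    have s0 : 0 <= s by move: st; rewrite in_itv => /andP[].
    exists (Num.truncn (s * N.+1%:R)) => //; split => //; split => //=.
    rewrite in_itv/= ler_pdivrMr// ltr_pdivlMr//.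
    by apply: truncn_itv; rewrite mulr_ge0.
  have mE k : measurable (E k).
    by apply: measurableX => //; apply: measurableI; exact: measurable_itv.
  rewrite DE; apply/measurable_fun_bigcup => // k.
  (* A strip whose left end lies beyond [t] is empty. *)
  have [kt|tk] := leP (k%:R / N.+1%:R) t; last first.
    suff -> : E k = set0 by exact: measurable_fun_set0.
    apply/seteqP; split => // -[s w] [[/=]]; rewrite !in_itv/=.
    move=> /andP[_ st] /andP[ks _] _.
    by move: (le_lt_trans (le_trans ks st) tk); rewrite ltxx.
  apply: (eq_measurable_fun (fun z : R * M => Z (k%:R / N.+1%:R) z.2)).
    move=> [s w]; rewrite inE => -[[/=]]; rewrite !in_itv/= => /andP[s0 _].
    rewrite ler_pdivrMr// ltr_pdivlMr// => /truncn_def ks _.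
    by rewrite /r ks.
  apply: measurable_funTS; apply: (measurableT_comp (f := Z _ : M -> R)) => //.
  by apply: mZ; rewrite in_itv/= kt divr_ge0.
- move=> [s w] [/= st _].
  have s0 : 0 <= s by move: st; rewrite in_itv => /andP[].
  have /(_ s st) cZs := proj1 (subspace_continuousP _ _) (cZ w).
  apply: (cvg_comp _ _ _ cZs) => P sP.
  have rs : r N s @[N --> \oo] --> s.
    apply/cvgrPdist_lt => e e0; near=> N.
    have /andP[_ rNs] := r_le N s s0.
    rewrite ger0_norm ?subr_ge0// ltrBlDl (lt_trans (r_lt N s s0))//.
    rewrite ltrD2l; near: N; exact: (near_infty_natSinv_lt (PosNum e0)).
  have rsP : \forall N \near \oo, r N s \in `[0, t] -> P (r N s) := rs _ sP.
  suff : \forall N \near \oo, P (r N s) by [].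
  apply: filterS rsP => N; apply; rewrite /= in_itv/=.
  have /andP[-> rNs] := r_le N s s0.
  by move: st; rewrite /= in_itv/= => /andP[_]; exact: le_trans.
Unshelve. all: by end_near. Qed.

(** It suffices to test open intervals. Their preimages under [f] are traces on the time strip of
    open sets [V] of the whole space, and [measurable_preimage_open_mx] handles [V]. *)
Lemma continuous_comp_jointly_measurable n p T
    (f : R -> 'cV[R]_n * 'cV[R]_p -> R)
    (X : R -> Omega -> 'cV[R]_n) (Y : R -> Omega -> 'cV[R]_p) : t <= T ->
  {within `[0, T] `*` [set: _], continuous (fun z => f z.1 z.2)} ->
  (forall i j, jointly_measurable (fun s w => X s w i j)) ->
  (forall i j, jointly_measurable (fun s w => Y s w i j)) ->
  jointly_measurable (fun s w => f s (X s w, Y s w)).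
Proof.
move=> tT /continuousP cf mX mY.
apply: (measurability _ (RGenOpens.measurableE R)).
move=> _ [_ [a [b ->] <-]].
have /cf/open_subspaceP[V oV VE] : open `]a, b[%classic
  by exact: interval_open.
have inT s : s \in `[0, t] -> s \in `[0, T].
  by rewrite /= !in_itv/= => /andP[-> /le_trans]; apply.
rewrite [X in measurable X](_ : _ = (`[0, t] `*` [set: M]) `&`
    [set z : R * M | V (z.1, (X z.1 z.2, Y z.1 z.2))]); last first.
  apply/seteqP; split => -[s w] [[/= st _]] sV; split => //.
    suff : (V `&` (`[0, T] `*` [set: _])) (s, (X s w, Y s w)) by case.
    by rewrite VE; split => //; split => //; exact: inT.
  suff : ((fun z => f z.1 z.2) @^-1` `]a, b[%classic `&` (`[0, T] `*` [set: _]))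
    (s, (X s w, Y s w)) by case.
  by rewrite -VE; split => //; split => //; exact: inT.
apply: (measurable_preimage_open_mx (S := (R * M)%type)) => //.
exact: measurable_funTS.
Qed.

End joint.

(** * Joint measurability of matrix-valued processes *)

Section joint_matrix.
Context {R : realType} {d : measure_display} {Omega : measurableType d}.
Implicit Types (G H : set (set Omega)).

(** This carries the control, progressive for the filtration of [Y], to the filtration [F]. The
    identity from the finer to the coarser measurable space is measurable. *)
Lemma jointly_measurableW G H (t : R) (f : R -> Omega -> R) : G `<=` H ->
  jointly_measurable G t f -> jointly_measurable H t f.
Proof.
move=> GH mf mD B mB.
pose MG := g_sigma_algebraType G; pose MH := g_sigma_algebraType H.
have mid : measurable_fun [set: MH] (id : MH -> MG).
  exact: (measurable_wrtW GH (@measurable_id _ MG _)).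
have mpair : measurable_fun [set: R * MH] (fun z => (z.1, z.2) : R * MG).
  apply: measurable_fun_pair; first exact: measurable_fst.
  exact: (measurableT_comp mid measurable_snd).
have mDG : measurable (`[0, t] `*` [set: MG] : set (R * MG)).
  by apply: measurableX => //; exact: measurable_itv.
have := mpair measurableT _ (mf mDG _ mB); rewrite setTI.
by congr (measurable _); apply/seteqP; split.
Qed.

Definition mx_jointly_measurable H (t : R) n p
    (A : R -> Omega -> 'M[R]_(n, p)) : Prop :=
  forall i j, jointly_measurable H t (fun s w => A s w i j).

Variables (H : set (set Omega)) (t : R).

Lemma mx_jointly_measurable_tr n p (A : R -> Omega -> 'M[R]_(n, p)) :
  mx_jointly_measurable H t A ->
  mx_jointly_measurable H t (fun s w => (A s w)^T).
Proof.
by move=> mA i j; apply: eq_measurable_fun (mA j i) => z _; rewrite mxE.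
Qed.

Lemma mx_jointly_measurable_mul n p q (A : R -> Omega -> 'M[R]_(n, p))
    (B : R -> Omega -> 'M[R]_(p, q)) :
  mx_jointly_measurable H t A -> mx_jointly_measurable H t B ->
  mx_jointly_measurable H t (fun s w => A s w *m B s w).
Proof.
move=> mA mB i j; apply: (eq_measurable_fun
  (fun z : R * g_sigma_algebraType H =>
    \sum_k A z.1 z.2 i k * B z.1 z.2 k j)) => [z _|]; first by rewrite mxE.
apply: measurable_sum => k; apply: measurable_funM; [exact: mA|exact: mB].
Qed.

Lemma progressive_jointly_measurable T F n p (A : R -> Omega -> 'M[R]_(n, p)) :
  t \in `[0, T] -> progressive T F A -> mx_jointly_measurable (F t) t A.
Proof. by move=> tT pA i j; exact: pA. Qed.

Lemma normsq_jointly_measurable n (A : R -> Omega -> 'rV[R]_n) :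
  mx_jointly_measurable H t A ->
  jointly_measurable H t (fun s w => normsq (A s w)).
Proof.
move=> mA; apply: mx_jointly_measurable_mul => //.
exact: mx_jointly_measurable_tr.
Qed.

End joint_matrix.

(* Applied with [S := SigmaY]: the [ds]-integrand of [chibar] is the squared norm
   of [filter_integrand], whose progressive measurability is part of being an Ito
   integrand; measurability of [invmx] is never needed. *)
Lemma normsq_pinv (R : realType) n p (a : 'cV[R]_n) (S : 'M[R]_(n, p)) :
  S *m S^T \in unitmx ->
  normsq (a^T *m invmx (S *m S^T) *m S) = (a^T *m invmx (S *m S^T) *m a) 0 0.
Proof.
move=> uS; rewrite /normsq !trmx_mul trmxK trmx_inv trmx_mul trmxK.
by rewrite !mulmxA -(mulmxA _ S S^T) mulmxKV.
Qed.

(** * Measurability in the model *)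

Section model_measurability.
Context {R : realType} {l n m1 m2 k : nat}.
Variables (C : coefficients R l n m1 m2 k) (T theta : R).
Context {d : measure_display} {Omega : measurableType d}.
Variables (P : probability Omega R) (F : R -> set (set Omega)).
Hypothesis hF : complete_filtration P T F.
Variables (W : R -> Omega -> 'cV[R]_(dimW l n m1 m2 k)).
Variables (X : R -> Omega -> 'cV[R]_n).
Variables (Y : R -> Omega -> 'cV[R]_(dimY l m1 m2 k)).
Variables (mu0 : set 'cV[R]_n -> \bar R) (y0 : 'cV[R]_(dimY l m1 m2 k)).
Hypothesis hXY : model_solution C T P F W X Y mu0 y0.
Variables (h : R -> Omega -> 'cV[R]_m1).
Variable t : R.
Hypothesis tT : t \in `[0, T].

Let t0 : 0 <= t. Proof. by move: tT; rewrite in_itv => /andP[]. Qed.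
Let t_le_T : t <= T. Proof. by move: tT; rewrite in_itv => /andP[]. Qed.

Lemma adapted_measurable_wrt q (Z : R -> Omega -> 'cV[R]_q) s i j :
  adapted T F Z -> s \in `[0, t] -> measurable_wrt (F t) (fun w => Z s w i j).
Proof.
move=> aZ; rewrite in_itv/= => /andP[s0 st].
apply: (@measurable_wrtW _ _ (F s)); first exact: (filtration_mono hF).
by apply: aZ; rewrite in_itv/= s0 (le_trans st).
Qed.

Lemma natural_filtration_sub q (Z : R -> Omega -> 'cV[R]_q) :
  adapted T F Z -> natural_filtration Z t `<=` F t.
Proof.
move=> aZ; apply: smallest_sub; first exact: (filtration_sigma hF).
move=> _ [u [i [B [ut mB ->]]]].
apply: (measurable_wrtP (filtration_sigma hF tT)) mB.
exact: adapted_measurable_wrt.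
Qed.

Lemma adapted_jointly_measurable q (Z : R -> Omega -> 'cV[R]_q) :
  adapted T F Z -> continuous_paths T Z -> mx_jointly_measurable (F t) t Z.
Proof.
move=> aZ cZ i j; apply: continuous_jointly_measurable => //.
  by move=> s st; exact: adapted_measurable_wrt.
move=> w; apply: continuous_subspaceW (cZ w i j) => s /=.
by rewrite !in_itv/= => /andP[-> /le_trans]; apply.
Qed.

Let mX := adapted_jointly_measurable (solution_X_adapted hXY)
  (solution_X_continuous hXY).
Let mY := adapted_jointly_measurable (solution_Y_adapted hXY)
  (solution_Y_continuous hXY).

Lemma Cb111_jointly_measurable f : Cb111 T f ->
  jointly_measurable (F t) t (fun s w => f s (X s w) (Y s w)).
Proof.
move=> [[cf _] _ _ _].
exact: (continuous_comp_jointly_measurable (f := fun s u => f s u.1 u.2)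
  t_le_T cf mX mY).
Qed.

(** Each row of [SigmaY] is an Ito integrand in the equation of [Y], hence progressive by
    [is_ito_integral]; [Sigma1] and [cf_Xi] are then blocks of its rows. *)
Lemma SigmaY_jointly_measurable :
  mx_jointly_measurable (F t) t (fun s w => SigmaY C s (Y s w)).
Proof.
move=> i j; have [pY _ _ _] := solution_Y hXY i.
by apply: eq_measurable_fun (pY t 0 j tT) => z _; rewrite mxE.
Qed.

Lemma Sigma1_jointly_measurable :
  mx_jointly_measurable (F t) t (fun s w => Sigma1 C s (Y s w)).
Proof.
move=> i j; apply: eq_measurable_fun
  (SigmaY_jointly_measurable (rshift l (lshift (1 + k) (lshift m2 i))) j) => z _.
by rewrite /SigmaY /Sigma1 col_mxEd col_mxEu mxE.
Qed.

Lemma Xi_jointly_measurable :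
  mx_jointly_measurable (F t) t (fun s w => cf_Xi C s (Y s w)).
Proof.
move=> i j; apply: eq_measurable_fun
  (SigmaY_jointly_measurable (rshift l (rshift (m1 + m2) (lshift k i))) j) => z _.
by rewrite /SigmaY !col_mxEd col_mxEu.
Qed.

(** The running cost is polynomial in the entries of [h], [a1], [cf_c], [Sigma1] and [cf_Xi], all
    jointly measurable along the paths. *)
Lemma measurable_exp_cost : coefficients_regular C T ->
  progressive T (natural_filtration Y) h ->
  measurable_wrt (F t) (exp_cost C theta X Y h t).
Proof.
move=> [_ [_ [_ [Ca [Cc _]]]]] ph.
have mh : mx_jointly_measurable (F t) t h.
  move=> i j; apply: jointly_measurableW (ph t i j tT).
  exact: natural_filtration_sub (solution_Y_adapted hXY).
have ma : mx_jointly_measurable (F t) t (fun s w => a1 C s (X s w) (Y s w)).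
  move=> i j; rewrite (ord1 j).
  apply: eq_measurable_fun (Cb111_jointly_measurable (Ca (lshift m2 i))) => z _.
  by rewrite /a1 mxE.
have mc := Cb111_jointly_measurable Cc.
have mS := Sigma1_jointly_measurable; have mXi := Xi_jointly_measurable.
have mhT := mx_jointly_measurable_tr mh.
apply: (measurableT_comp (f := expR)) => //.
apply: measurable_funM; first exact: measurable_cst.
apply: measurable_wrt_Rintegral.
rewrite /jointly_measurable /gcost.
have quad := mx_jointly_measurable_mul (mx_jointly_measurable_mul mhT
  (mx_jointly_measurable_mul mS (mx_jointly_measurable_tr mS))) mh 0 0.
have lin := mx_jointly_measurable_mul mhT ma 0 0.
have cross := mx_jointly_measurable_mul mhT
  (mx_jointly_measurable_mul mS (mx_jointly_measurable_tr mXi)) 0 0.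
have mN := normsq_jointly_measurable mXi.
have scale (c : R) f : jointly_measurable (F t) t f ->
    jointly_measurable (F t) t (fun s w => c * f s w).
  by move=> mf; apply: measurable_funM => //; exact: measurable_cst.
apply: measurable_funD (scale _ _ mN); apply: measurable_funD mc.
apply: measurable_funB (scale _ _ cross).
exact: measurable_funB (scale _ _ quad) lin.
Qed.

(** Both ingredients come from [is_ito_integral]: [I t] is [F t]-measurable and the integrand
    [gamma] is progressive. *)
Lemma measurable_chi (I : R -> Omega -> R) :
  is_ito_integral P T F W (gamma C Y h) I ->
  measurable_wrt (F t) (chi C theta Y h I t).
Proof.
move=> [pg mI _ _]; apply: (measurableT_comp (f := expR)) => //.
apply: measurable_funB; apply: measurable_funM; do ?exact: measurable_cst.
  exact: mI.
apply: measurable_wrt_Rintegral; apply: normsq_jointly_measurable.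
exact: progressive_jointly_measurable pg.
Qed.

Lemma measurable_chibar (Ph : probability Omega R) (J : R -> Omega -> R) :
  coefficients_nondegenerate C T ->
  is_ito_integral Ph T F (Wh C theta W Y h) (filter_integrand C theta X Y h) J ->
  measurable_wrt (F t) (chibar C theta X Y h J t).
Proof.
move=> [_ uS] [pg mJ _ _]; apply: (measurableT_comp (f := expR)) => //.
apply: measurable_funB; first by apply: measurableT_comp => //; exact: mJ.
apply: measurable_funM; first exact: measurable_cst.
suff -> : (fun w => \int[lebesgue_measure]_(s in `[0, t])
      (((adagger C theta s (X s w) (Y s w) (h s w))^T
        *m invmx (SigmaYY C s (Y s w))
        *m adagger C theta s (X s w) (Y s w) (h s w)) 0 0)) =
    (fun w => \int[lebesgue_measure]_(s in `[0, t])
      normsq (filter_integrand C theta X Y h s w)).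
  apply: measurable_wrt_Rintegral; apply: normsq_jointly_measurable.
  exact: progressive_jointly_measurable pg.
apply/funext => w; apply: eq_Rintegral => s.
rewrite inE/= in_itv/= => /andP[s0 st]; rewrite /filter_integrand normsq_pinv//.
by apply: uS; rewrite in_itv/= s0 (le_trans st).
Qed.

Lemma measurable_test_function phi : test_function T phi ->
  measurable_wrt (F t) (fun w => phi t (X t w) (Y t w)).
Proof.
move=> [_ /(_ t tT) mphi].
pose U := g_sigma_algebraType (@open ('cV[R]_n * 'cV[R]_(dimY l m1 m2 k))%type).
pose M := g_sigma_algebraType (F t).
suff mXYt : measurable_fun [set: M] (fun w => (X t w, Y t w) : U).
  exact: (measurableT_comp mphi mXYt).
apply: (@measurability _ _ M U setT _ _ erefl).
move=> _ [V oV <-].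
have tt : t \in `[0, t] by rewrite in_itv/= t0 lexx.
(* The time coordinate is frozen at the dummy value [0], and [V] is replaced by its cylinder in the
   triple product. *)
apply: (@measurable_preimage_open_mx _ _ M setT measurableT _ _
  (cst 0) (X t) (Y t) (snd @^-1` V)).
- exact: measurable_cst.
- by move=> i j; exact: adapted_measurable_wrt (solution_X_adapted hXY) tt.
- by move=> i j; exact: adapted_measurable_wrt (solution_Y_adapted hXY) tt.
- by apply: open_comp => // z _; exact: cvg_snd.
Qed.

End model_measurability.

(** * The generalized Kallianpur-Striebel formula *)

Theorem proposition5p1
    (R : realType) (T theta : R) (l n m1 m2 k : nat)
    (T_gt0 : 0 < T) (n_ge1 : (1 <= n)%N) (m1_ge1 : (1 <= m1)%N)
    (theta_range : (-1 < theta /\ theta < 0) \/ 0 < theta)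
    (d : measure_display) (Omega : measurableType d) (P : probability Omega R)
    (F : R -> set (set Omega)) (hF : complete_filtration P T F)
    (W : R -> Omega -> 'cV[R]_(dimW l n m1 m2 k)) (hW : wiener P T F W)
    (C : coefficients R l n m1 m2 k)
    (C_regular : coefficients_regular C T)
    (C_nondegenerate : coefficients_nondegenerate C T)
    (X : R -> Omega -> 'cV[R]_n) (Y : R -> Omega -> 'cV[R]_(dimY l m1 m2 k))
    (mu0 : probability (g_sigma_algebraType (@open 'cV[R]_n)) R)
    (y0 : 'cV[R]_(dimY l m1 m2 k))
    (hXY : model_solution C T P F W X Y mu0 y0)
    (h : R -> Omega -> 'cV[R]_m1) (Ph Pbar : probability Omega R)
    (I J : R -> Omega -> R)
    (hI : is_ito_integral P T F W (gamma C Y h) I)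
    (hPh : density_on T F P Ph (chi C theta Y h I))
    (hJ : is_ito_integral Ph T F (Wh C theta W Y h)
            (filter_integrand C theta X Y h) J)
    (hPbar : density_on T F Ph Pbar (chibar C theta X Y h J))
    (h_in_AX : classAX T theta P Y h Ph I J)
    (phi : R -> 'cV[R]_n -> 'cV[R]_(dimY l m1 m2 k) -> R)
    (hphi : test_function T phi)
    (t : R) (ht : t \in `[0, T])
    (Eh Ebar EPsi q : Omega -> \bar R)
    (hEh : is_condexp Ph (natural_filtration Y t)
             (fun w => phi t (X t w) (Y t w) * exp_cost C theta X Y h t w) Eh)
    (hEbar : is_condexp Pbar (natural_filtration Y t)
               (fun w => phi t (X t w) (Y t w) * exp_cost C theta X Y h t w
                         * PsiX C theta X Y h J t w) Ebar)
    (hEPsi : is_condexp Pbar (natural_filtration Y t)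
               (PsiX C theta X Y h J t) EPsi)
    (hq : is_qX C theta X Y h Pbar J phi t q) :
  {ae P, forall w, Eh w = (Ebar w / EPsi w)%E
                   /\ (Ebar w / EPsi w)%E = (q w / EPsi w)%E}.
Proof.
have sF := filtration_sigma hF ht; have Fm := filtration_sub hF ht.
pose G := natural_filtration Y t.
have sG : sigma_algebra [set: Omega] G by exact: smallest_sigma_algebra.
have GF : G `<=` F t.
  exact: (natural_filtration_sub hF ht (solution_Y_adapted hXY)).
have mchi := measurable_chi theta ht hI.
have mchibar := measurable_chibar ht C_nondegenerate hJ.
have mphi := measurable_test_function hF hXY ht hphi.
have mcost := measurable_exp_cost theta hF hXY ht C_regular
  (classAX_progressive h_in_AX).
have mZ : measurable_wrt (F t)
    (fun w => phi t (X t w) (Y t w) * exp_cost C theta X Y h t w).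
  exact: measurable_funM.
have chibar_gt0 w : 0 < chibar C theta X Y h J t w by exact: expR_gt0.
have hPbart A : F t A -> _ := hPbar t A ht.
have hq' : is_condexp Pbar G (fun w =>
    phi t (X t w) (Y t w) * exp_cost C theta X Y h t w
    / chibar C theta X Y h J t w) q.
  move: hq; rewrite /is_qX; congr (is_condexp _ _ _ _); apply/funext => w.
  by rewrite mulrC mulrA.
(* Bayes' formula with [Q = Ph], [Q' = Pbar] and [D = chibar], so that [1/D] is [PsiX]; it is used
   for [Ebar] and then for [q], and both quotients are compared with [Eh]. *)
have [N1 [GN1 N10 N1E]] := condexp_bayes sG sF GF Fm chibar_gt0 mchibar hPbart
  mZ hEh hEbar hEPsi.
have [N2 [GN2 N20 N2E]] := condexp_bayes sG sF GF Fm chibar_gt0 mchibar hPbart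
  mZ hEh hq' hEPsi.
(* The exceptional sets are [Ph]-null; positivity of [chi], the density of [Ph] with respect to [P]
   on [F t], makes them [P]-null. *)
have PN N : G N -> Ph N = 0%E -> P.-negligible N.
  move=> /GF FN N0; apply/negligibleP; first exact: Fm.
  apply: (density_null sF Fm _ mchi _ FN N0) => [w|A FA]; first exact: expR_gt0.
  exact: hPh.
have := negligibleU (PN _ GN1 N10) (PN _ GN2 N20); apply: negligibleS => w /= nE.
apply: contrapT => /not_orP[/N1E E1 /N2E E2]; apply: nE.
by rewrite -E1 -E2.
Qed.
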